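(* Let $n$ be a positive integer, and let $\mathcal{S}_2$ be the variety of all lattices satisfying both identities $(SD_2^\wedge)$ and $(SD_2^\vee)$. If the relatively free lattice $F_{\mathcal{S}_2}(n)$ is finite, then $F_{\mathcal{S}_2}(n)$ is a bounded lattice (in the sense of being a bounded homomorphic image of a free lattice).
   Context: $(SD_2^\wedge)$ is the lattice identity $x \wedge (y \vee z) = x \wedge \bigl(y \vee (x \wedge (z \vee (x \wedge y)))\bigr)$, and $(SD_2^\vee)$ is its dual $x \vee (y \wedge z) = x \vee \bigl(y \wedge (x \vee (z \wedge (x \vee y)))\bigr)$. For a variety $\mathcal{V}$ of lattices and a set $X$, the relatively free lattice $F_{\mathcal{V}}(X)$ is the lattice in $\mathcal{V}$ generated by $X$, unique up to isomorphism, such that for every lattice $L$ in $\mathcal{V}$ and every map $f : X \to L$ there is a lattice homomorphism $h : F_{\mathcal{V}}(X) \to L$ with $h(x) = f(x)$ for all $x \in X$. One writes $F_{\mathcal{V}}(n)$ for $F_{\mathcal{V}}(X)$ when $|X| = n$. ''Bounded lattice'' is meant in McKenzie's sense, as standard in the theory of free lattices; it does not refer to the existence of a maximum or minimum element. A lattice homomorphism $f : K \to L$ is lower bounded if for every $a \in L$ the set $\{u \in K : f(u) \geq a\}$ is either empty or has a least element; it is upper bounded if for every $a \in L$ the set $\{u \in K : f(u) \leq a\}$ is either empty or has a greatest element; it is bounded if it is both lower and upper bounded. A finite lattice $L$ is a bounded lattice if there are a finite set $X$ and a bounded surjective lattice homomorphism from the free lattice $FL(X)$ onto $L$. *)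

(* Defs.v *)
From mathcomp Require Export all_boot all_order.
From mathcomp Require Export boolp classical_sets functions cardinality.

Set Implicit Arguments.
Unset Strict Implicit.
Unset Printing Implicit Defensive.

Local Open Scope order_scope.

Definition SD2_meet (d : Order.disp_t) (L : latticeType d) : Prop :=
  forall x y z : L, x `&` (y `|` z) = x `&` (y `|` (x `&` (z `|` (x `&` y)))).

Definition SD2_join (d : Order.disp_t) (L : latticeType d) : Prop :=
  forall x y z : L, x `|` (y `&` z) = x `|` (y `&` (x `|` (z `&` (x `|` y)))).

(* A display is only a tag controlling notations: quantifying over it lets a
   class range over all lattices. *)
Definition lattice_class := forall d : Order.disp_t, latticeType d -> Prop.

Definition S2 : lattice_class := fun d L => SD2_meet L /\ SD2_join L.

Definition all_lattices : lattice_class := fun d L => True.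

Definition generated_by (X : Type) (d : Order.disp_t) (F : latticeType d)
    (i : X -> F) : Prop :=
  forall S : set F,
    (forall x, S (i x)) ->
    (forall u v, S u -> S v -> S (u `&` v)) ->
    (forall u v, S u -> S v -> S (u `|` v)) ->
    forall u, S u.

(* F is the relatively free lattice F_V(X), with X sitting in F through i.
   The injectivity of i is not required separately: it follows from the
   extension property as soon as V contains a lattice with two elements. *)
Definition relatively_free (V : lattice_class) (X : Type) (d : Order.disp_t)
    (F : latticeType d) (i : X -> F) : Prop :=
  [/\ V d F,
      generated_by i &
      forall (d' : Order.disp_t) (L : latticeType d') (f : X -> L), V d' L ->
        exists h : {lmorphism F -> L}, forall x, h (i x) = f x].

Definition is_free_lattice (X : Type) (d : Order.disp_t) (F : latticeType d) :
    Prop :=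
  exists i : X -> F, relatively_free all_lattices i.

(* F is F_V(n). *)
Definition relatively_free_on (V : lattice_class) (n : nat)
    (d : Order.disp_t) (F : latticeType d) : Prop :=
  exists (X : finType) (i : X -> F), #|X| = n /\ relatively_free V i.

Definition lower_bounded (d d' : Order.disp_t) (K : latticeType d)
    (L : latticeType d') (f : K -> L) : Prop :=
  forall a : L, let A := [set u | a <= f u]%classic in
    A = set0 \/ exists m, A m /\ lbound A m.

Definition upper_bounded (d d' : Order.disp_t) (K : latticeType d)
    (L : latticeType d') (f : K -> L) : Prop :=
  forall a : L, let A := [set u | f u <= a]%classic in
    A = set0 \/ exists m, A m /\ ubound A m.

Definition bounded_hom (d d' : Order.disp_t) (K : latticeType d)
    (L : latticeType d') (f : K -> L) : Prop :=
  lower_bounded f /\ upper_bounded f.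

(* Bounded in McKenzie's sense, unrelated to the existence of a top or a
   bottom element. *)
Definition bounded_lattice (d : Order.disp_t) (L : latticeType d) : Prop :=
  finite_set [set: L]%classic /\
  exists (X : finType) (d' : Order.disp_t) (FL : latticeType d')
         (f : {lmorphism FL -> L}),
    [/\ is_free_lattice X FL,
        set_surj [set: FL]%classic [set: L]%classic f &
        bounded_hom f].

(* Main.v *)
From HB Require Import structures.
From Stdlib Require Import Relation_Operators.
From mathcomp Require Import finmap generic_quotient.
Require Import Defs.

(** Freeness enters through the finite generating set it supplies: if a finite
    lattice [L] satisfying both identities is generated by a finite set [X],
    then the canonical homomorphism from the free lattice on [X] onto [L] is
    bounded ([near_distributive_bounded]).

    The key is a property of single elements.  Say that [c] does not separate
    [y <= x] when [x] and [y] have the same join and the same meet with [c].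
    In a lattice satisfying the two identities, this relation between [x] and
    [y] is stable under joining or meeting both with a third element
    ([inseparableU], [inseparableI]): for joins this is one application of the
    join identity, for meets one application of its dual.

    McKenzie's criterion reduces lower boundedness of a homomorphism onto a
    finite lattice to the absence of cycles in a dependency relation between
    join irreducible elements: [a] depends on [b] when, for some [p] above the
    lower cover of [b], [a <= b `|` p] although [a] is not below [p].  The meet
    identity shows that then [b < a], or else [b] does not separate [a] from
    its lower cover ([depends_lt_or_inseparable]).  By the stability above,
    inseparability from the lower cover passes from [b] to every [a] that
    depends on [b] ([depends_inseparable]).  On a cycle a step of the second
    kind would thus come back to [b] itself, which certainly separates itself
    from its lower cover; and a cycle cannot consist of strict descents only.
    So dependency is well founded ([depends_wf]).

    Well-founded recursion along dependency then builds the least elements of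
    the preimages of up-sets.  If [a <= y `|` z] nontrivially, the dependencies
    of [a] already provide a join cover of [a] refining [y] and [z] by elements
    dealt with before, and finitely many such covers together with the
    generators above [a] determine the least element for [a] as a finite meet
    ([has_least_preimage_of_covers], [has_least_preimage_of_depends]).  Upper
    boundedness follows by passing to the dual lattices. *)

Set Implicit Arguments.
Unset Strict Implicit.
Unset Printing Implicit Defensive.

Import Order.TTheory.
Local Open Scope order_scope.

(** * Finite relations and finite orders *)

(** The number of elements from which [x] can be reached decreases along [R]:
    by acyclicity, [y] does not reach itself, whereas it reaches [x]. *)
Lemma finite_acyclic_wf (T : Type) (R : T -> T -> Prop) :
  finite_set [set: T]%classic -> (forall x, ~ clos_trans T R x x) ->
  well_founded R.
Proof.
elim/Pchoice: T => T in R *; move=> finT acyclic x.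
pose below z := fset_set [set y | clos_trans T R y z]%classic.
have fin z : finite_set [set y | clos_trans T R y z]%classic.
  exact: sub_finite_set finT.
have [n lt_x_n] := ubnP #|` below x|%fset.
elim: n x lt_x_n => [x|n IHn x lt_x_n]; first by rewrite ltn0.
constructor=> y Ryx; apply: IHn.
rewrite ltnS in lt_x_n; apply: leq_trans lt_x_n.
apply/fproper_ltn_card; rewrite fproperE; apply/andP; split.
  apply/fsubsetP=> z.
  rewrite !in_fset_set // !inE /= => zy.
  by apply: t_trans zy _; apply: t_step.
apply/negP=> /fsubsetP/(_ y); rewrite !in_fset_set // !inE /=.
by move/(_ (t_step _ _ _ _ Ryx)) => /acyclic.
Qed.

Lemma finite_minimal (d : Order.disp_t) (T : porderType d) (P : T -> Prop)
    (x : T) :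
  finite_set [set: T]%classic -> P x ->
  exists m, [/\ m <= x, P m & forall y, y < m -> ~ P y].
Proof.
move=> finT; have wf : well_founded (fun y z : T => y < z).
  apply: finite_acyclic_wf finT _ => z /[dup].
  have lt u v : clos_trans T (fun y z => y < z) u v -> u < v.
    by elim=> // a b c _ ab _; apply: lt_trans.
  by move=> /lt; rewrite ltxx.
elim/(well_founded_ind wf): x => x IHx Px.
have [[y [lt_yx Py]]|nP] := EM (exists y, y < x /\ P y).
  have [m [le_my Pm min_m]] := IHx y lt_yx Py.
  by exists m; split=> //; apply: le_trans le_my (ltW lt_yx).
by exists x; split=> // y lt_yx Py; apply: nP; exists y.
Qed.

Lemma finite_maximal (d : Order.disp_t) (T : porderType d) (P : T -> Prop)
    (x : T) :
  finite_set [set: T]%classic -> P x ->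
  exists m, [/\ x <= m, P m & forall y, m < y -> ~ P y].
Proof. exact: (@finite_minimal _ T^d). Qed.

(** * Inseparable pairs in near-distributive lattices *)

(** Given [y <= x], the two other inequalities say that [x] and [y] have the
    same join and the same meet with [c]: unless [x = y], the three elements
    generate a pentagon. *)
Definition inseparable (d : Order.disp_t) (L : latticeType d) (c x y : L) :
    Prop :=
  [/\ y <= x, x <= y `|` c & x `&` c <= y].

(** With [q] for [y `|` z], the join identity reads
    [q `|` (c `&` x) = q `|` (c `&` (q `|` (x `&` (q `|` c))))]; here the left
    side collapses to [q] and [x] is below [q `|` c], so [c `&` (q `|` x)] is
    below [q]. *)
Lemma inseparableU (d : Order.disp_t) (L : latticeType d) (c x y z : L) :
  SD2_join L -> inseparable c x y -> inseparable c (x `|` z) (y `|` z).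
Proof.
move=> SD [le_yx le_x_yc le_xc_y]; split; first exact: leU2.
  by rewrite joinAC; apply: leU2.
have := SD (y `|` z) c x.
rewrite [c `&` x]meetC (join_l (le_trans le_xc_y (leUl y z))).
rewrite [x `&` _]meet_l; last first.
  by rewrite joinAC; apply: le_trans le_x_yc (leUl _ _).
move=> /esym/join_idPl; rewrite meetC joinAC.
by rewrite [y `|` x]joinC (join_l le_yx).
Qed.

Lemma inseparableI (d : Order.disp_t) (L : latticeType d) (c x y z : L) :
  SD2_meet L -> inseparable c x y -> inseparable c (x `&` z) (y `&` z).
Proof.
move=> SD [le_yx le_x_yc le_xc_y].
by have [] // := @inseparableU _ L^d c y x z SD.
Qed.

(** * The dependency relation *)

(** Complete join irreducibility, with the lower cover [a'] made explicit; the
    bottom is excluded. *)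
Definition join_irred_over (d : Order.disp_t) (L : latticeType d) (a a' : L) :
    Prop :=
  a' < a /\ forall x, x < a -> x <= a'.

(** The witness [b] is a minimal element below [y] and not below [q]: whatever
    lies strictly under it is then below [q], so [b `&` q] is its only lower
    cover. *)
Lemma join_irred_not_below (d : Order.disp_t) (L : latticeType d) (y q : L) :
  finite_set [set: L]%classic -> ~ y <= q ->
  exists b b', [/\ join_irred_over b b', b <= y, ~ b <= q & b' <= q].
Proof.
move=> L_fin nle_yq.
have [b [_ [le_by nle_bq] min_b]] :=
  @finite_minimal _ L (fun b => b <= y /\ ~ b <= q) y L_fin
    (conj (lexx y) nle_yq).
exists b, (b `&` q); split=> //; last exact: leIr.
split=> [|x lt_xb].
  rewrite lt_neqAle leIl andbT.
  by apply: contra_notN nle_bq => /eqP/meet_idPl.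
rewrite lexI (ltW lt_xb) /=; have [//|/negP nle_xq] := boolP (x <= q).
exfalso; apply: (min_b x lt_xb); split=> //.
exact: le_trans (ltW lt_xb) le_by.
Qed.

(** The relation D of the theory of free lattices, whose acyclicity
    characterizes the finite lower bounded lattices.  Usually [a] is required
    not to be below [b' `|` p]; replacing [p] by [b' `|` p] gives this form. *)
Definition depends (d : Order.disp_t) (L : latticeType d) (a b : L) : Prop :=
  exists a' b' p,
    [/\ join_irred_over a a', join_irred_over b b' & a != b] /\
    [/\ b' <= p, a <= b `|` p & ~ a <= p].

Definition ji_inseparable (d : Order.disp_t) (L : latticeType d) (c a : L) :
    Prop :=
  exists a', join_irred_over a a' /\ inseparable c a a'.

(** The meet identity for [a], [b], [p] puts [a] below
    [b `|` (a `&` (p `|` (a `&` b)))].  If [b] is not below [a], then [a `&` b]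
    is below the lower cover of [b], hence below [p], and the inner term is a
    proper minorant of [a]. *)
Lemma depends_lt_or_inseparable (d : Order.disp_t) (L : latticeType d)
    (a b : L) :
  SD2_meet L -> depends a b -> b < a \/ ji_inseparable b a.
Proof.
move=> SD [a' [b' [p [[jia jib neq_ab] [le_b'p le_a_bp nle_ap]]]]].
have lt_ba_or_nle : b < a \/ ~ b <= a.
  have [le_ba|] := boolP (b <= a); last by right; apply/negP.
  by left; rewrite lt_neqAle eq_sym neq_ab.
have [|nle_ba] := lt_ba_or_nle; first by left.
right; exists a'; split=> //.
have le_ab_p : a `&` b <= p.
  apply: le_trans le_b'p; apply: jib.2; rewrite lt_neqAle leIr andbT.
  by apply: contra_notN nle_ba => /eqP/meet_idPr.
have nle_ab : ~ a <= b.
  by move=> /meet_idPl eq_ab; apply: nle_ap; rewrite -eq_ab.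
split; first exact: ltW jia.1.
  have := SD a b p; rewrite (meet_l le_a_bp) => /esym/meet_idPl le_a.
  apply: le_trans le_a _; rewrite joinC; apply: leU2 => //; apply: jia.2.
  rewrite lt_neqAle leIl andbT; apply: contra_notN nle_ap => /eqP/meet_idPl.
  by rewrite (join_l le_ab_p).
apply: jia.2; rewrite lt_neqAle leIl andbT.
by apply: contra_notN nle_ab => /eqP/meet_idPl.
Qed.

(** Joining [b] and its lower cover with [p] and then meeting with [a] turns
    them into [a] and a proper minorant of [a]. *)
Lemma depends_inseparable (d : Order.disp_t) (L : latticeType d) (a b c : L) :
  SD2_meet L -> SD2_join L ->
  depends a b -> ji_inseparable c b -> ji_inseparable c a.
Proof.
move=> SDm SDj [a' [b1 [p [[jia jib1 _] [le_b1p le_a_bp nle_ap]]]]].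
move=> [b' [jib insep]]; exists a'; split=> //.
have le_b'p : b' <= p by apply: le_trans le_b1p; apply: jib1.2 jib.1.
have := inseparableI a SDm (inseparableU p SDj insep).
rewrite (join_r le_b'p) [(b `|` p) `&` a]meetC (meet_l le_a_bp).
case=> le_pa_a le_a_pac le_ac_pa.
have le_pa_a' : p `&` a <= a'.
  apply: jia.2; rewrite lt_neqAle le_pa_a andbT.
  by apply: contra_notN nle_ap => /eqP/meet_idPr.
split; first exact: ltW jia.1.
  by apply: le_trans le_a_pac _; apply: leU2.
exact: le_trans le_ac_pa le_pa_a'.
Qed.

Lemma ji_inseparable_irrefl (d : Order.disp_t) (L : latticeType d) (a : L) :
  ~ ji_inseparable a a.
Proof.
move=> [a' [[lt_a'a _] [_ _]]]; rewrite meetxx => le_aa'.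
by have := lt_le_trans lt_a'a le_aa'; rewrite ltxx.
Qed.

Lemma depends_wf (d : Order.disp_t) (L : latticeType d) :
  finite_set [set: L]%classic -> SD2_meet L -> SD2_join L ->
  well_founded (fun b a : L => depends a b).
Proof.
move=> finL SDm SDj; apply: finite_acyclic_wf finL _.
pose path := clos_trans L (fun b a => depends a b).
have path_insep b a : path b a ->
    forall c, ji_inseparable c b -> ji_inseparable c a.
  elim=> {b a} [b a ab|b e a _ IHbe _ IHea] c; first exact: depends_inseparable.
  by move=> /IHbe; apply: IHea.
(* If [b] leads back to [a], a step from [a] to [b] is a descent: otherwise [b]
   does not separate [a] from its lower cover, and going around the cycle it
   would not separate itself from its own lower cover either. *)
have lt_path b a : path b a -> a = b \/ path a b -> b < a.
  elim=> {b a} [b a ab back|b e a be IHbe ea IHea back].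
    have [//|insep] := depends_lt_or_inseparable SDm ab.
    exfalso; apply: (@ji_inseparable_irrefl _ _ b).
    by case: back => [eq_ab|/path_insep]; [rewrite eq_ab in insep|apply].
  have {}back : path a b \/ a = b by case: back; [right|left].
  apply: lt_trans (IHbe _) (IHea _).
    by right; case: back => [ab|<-//]; apply: t_trans ea ab.
  by right; case: back => [ab|->//]; apply: t_trans ab be.
by move=> x xx; have := lt_path x x xx (or_introl erefl); rewrite ltxx.
Qed.

(** * Lower bounded homomorphisms *)

Definition has_least_preimage (d d' : Order.disp_t) (K : latticeType d)
    (L : latticeType d') (f : K -> L) (a : L) : Prop :=
  exists m, a <= f m /\ forall u, a <= f u -> m <= u.

Lemma finite_lower_bound_in (d : Order.disp_t) (K : latticeType d)
    (P : K -> Prop) (W : set K) (u0 : K) :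
  finite_set W -> P u0 -> (forall u v, P u -> P v -> P (u `&` v)) ->
  exists m, P m /\ forall w, W w -> P w -> m <= w.
Proof.
move=> /finite_seqP[s ->] Pu0 PI; elim: s => [|w s [m [Pm le_m]]].
  by exists u0; split=> // w; rewrite /= in_nil.
have [Pw|nPw] := EM (P w); last first.
  by exists m; split=> // v /=; rewrite in_cons => /orP[/eqP->//|/le_m].
exists (m `&` w); split; first exact: PI.
move=> v /=; rewrite in_cons => /orP[/eqP-> _|/le_m le_mv Pv].
  exact: leIr.
by apply: le_trans (leIl _ _) (le_mv Pv).
Qed.

Section LowerBounded.
Variables (d d' : Order.disp_t) (K : latticeType d) (L : latticeType d').
Variables (X : finType) (i : X -> K) (f : K -> L).
Hypotheses (i_gen : generated_by i) (f_surj : forall a, exists u, f u = a).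
Hypotheses (fI : {morph f : u v / u `&` v}) (fU : {morph f : u v / u `|` v}).
Hypothesis L_fin : finite_set [set: L]%classic.

Let f_homo u v : u <= v -> f u <= f v.
Proof. by move=> /meet_idPl uv; rewrite -uv fI leIr. Qed.

Lemma has_least_preimageU (a b : L) :
  has_least_preimage f a -> has_least_preimage f b ->
  has_least_preimage f (a `|` b).
Proof.
move=> [m [am m_le]] [n [bn n_le]]; exists (m `|` n); split.
  by rewrite fU leU2.
by move=> u; rewrite leUx => /andP[/m_le mu /n_le nu]; rewrite leUx mu.
Qed.

(** The witness is the meet, inside the preimage of the up-set of [a], of the
    finitely many elements that are generators or joins of two least preimages
    already found.  That it bounds every element of this preimage is checked by
    induction on how the element is generated: only joins need an argument,
    and there the refined cover gives one of the finitely many elements. *)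
Lemma has_least_preimage_of_covers (a : L) :
  (forall y z, a <= y `|` z -> [\/ a <= y, a <= z |
     exists y' z', [/\ y' <= y, z' <= z, a <= y' `|` z' &
       has_least_preimage f y' /\ has_least_preimage f z']]) ->
  has_least_preimage f a.
Proof.
move=> covers.
(* [g] chooses the least preimages, and is arbitrary where there is none. *)
pose least_for y m := has_least_preimage f y ->
  y <= f m /\ forall u, y <= f u -> m <= u.
have /boolp.choice[g g_least] : forall y, exists m, least_for y m.
  move=> y; have [[m mP]|nP] := EM (has_least_preimage f y); first by exists m.
  by have [u _] := f_surj a; exists u.
pose W :=
  (range i `|` [set Order.join (g y) (g z) | y in setT & z in setT])%classic.
have finW : finite_set W.
  rewrite finite_setU; split; last exact: finite_image2.
  exact/finite_image/finite_finset.
have [u0 fu0] := f_surj a.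
have [||m [am m_le]] :=
  @finite_lower_bound_in _ K (fun u => a <= f u) W u0 finW.
- by rewrite fu0.
- by move=> u v au av; rewrite fI lexI au.
exists m; split=> // u; apply: (i_gen (S := fun u => a <= f u -> m <= u)) u.
- by move=> x; apply: m_le; left; exists x.
- move=> u v mu mv; rewrite fI lexI => /andP[/mu m_le_u /mv m_le_v].
  by rewrite lexI m_le_u.
move=> u v mu mv; rewrite fU => /covers[/mu le_mu|/mv le_mv|].
- exact: le_trans le_mu (leUl _ _).
- exact: le_trans le_mv (leUr _ _).
move=> [y [z [yu zv a_yz [/g_least[y_gy gy_le] /g_least[z_gz gz_le]]]]].
apply: (@le_trans _ _ (g y `|` g z)); last first.
  by apply: leU2; [apply: gy_le|apply: gz_le].
apply: m_le; first by right; exists y => //; exists z.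
by rewrite fU; apply: le_trans a_yz _; apply: leU2.
Qed.

(** The elements having a least preimage are closed under joins, and the bottom
    is one of them because it has no nontrivial join cover. *)
Lemma greatest_with_least_preimage (y : L) :
  exists m, [/\ m <= y, has_least_preimage f m &
    forall b, b <= y -> has_least_preimage f b -> b <= m].
Proof.
have [o [_ _ o_min]] := @finite_minimal _ L (fun=> True) y L_fin I.
have o_bot x : o <= x.
  have [/eqP oEx|neq] := boolP (o == o `&` x); first by rewrite oEx leIr.
  exfalso; apply: (o_min (o `&` x)) => //.
  by rewrite lt_neqAle eq_sym neq leIl.
have o_least : has_least_preimage f o.
  by apply: has_least_preimage_of_covers => *; apply: Or31.
have [m [_ [le_my m_least] max_m]] := @finite_maximal _ L
  (fun m => m <= y /\ has_least_preimage f m) o L_fin (conj (o_bot y) o_least).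
exists m; split=> // b le_by b_least.
have [//|nle_bm] := boolP (b <= m); exfalso.
apply: (max_m (m `|` b)); last first.
  by split; [rewrite leUx le_my|apply: has_least_preimageU].
rewrite lt_neqAle leUl andbT.
by apply: contraNN nle_bm => /eqP {1}->; rewrite leUr.
Qed.

(** Let [y0] and [z0] be the greatest elements below [y] and [z] that have a
    least preimage.  If [a] were not below their join, enlarge this join to a
    maximal [q] not above [a].  One of [y], [z] is not below [q]; a join
    irreducible [b] witnessing this has its lower cover below [q], and
    [a <= b `|` q] by maximality, so [a] depends on [b].  Hence [b] has a least
    preimage and is below [y0] or [z0], that is, below [q], which is absurd. *)
Lemma has_least_preimage_of_depends (a a' : L) :
  join_irred_over a a' ->
  (forall b, depends a b -> has_least_preimage f b) -> has_least_preimage f a.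
Proof.
move=> jia IHa; apply: has_least_preimage_of_covers => y z le_a_yz.
have [le_ay|/negP nle_ay] := boolP (a <= y); first exact: Or31.
have [le_az|/negP nle_az] := boolP (a <= z); first exact: Or32.
have [y0 [le_y0y y0_least y0_max]] := greatest_with_least_preimage y.
have [z0 [le_z0z z0_least z0_max]] := greatest_with_least_preimage z.
apply: Or33; exists y0, z0; split=> //.
have [//|/negP nle_a0] := boolP (a <= y0 `|` z0); exfalso.
have [q [le_0q nle_aq max_q]] :=
  @finite_maximal _ L (fun q => ~ a <= q) _ L_fin nle_a0.
have below w : ~ a <= w ->
    (forall b, b <= w -> has_least_preimage f b -> b <= q) -> w <= q.
  move=> nle_aw w_q; have [//|/negP nle_wq] := boolP (w <= q); exfalso.
  have [b [b' [jib le_bw nle_bq le_b'q]]] := join_irred_not_below L_fin nle_wq.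
  apply: (nle_bq); apply: w_q => //.
  apply: IHa; exists a', b', q; do 2!split=> //.
    by apply: contra_notN nle_aw => /eqP->.
  have [//|/negP nle_a] := boolP (a <= b `|` q); exfalso.
  apply: (max_q (b `|` q)) nle_a; rewrite lt_neqAle leUr andbT.
  by apply: contra_notN nle_bq => /eqP->; rewrite leUl.
case: (EM (y <= q /\ z <= q)) => [[yq zq]|[]].
  by apply: nle_aq; apply: le_trans le_a_yz _; rewrite leUx yq.
move: le_0q; rewrite leUx => /andP[y0q z0q].
by split; apply: below => // b bw b_least;
  [apply: le_trans y0q; apply: y0_max|apply: le_trans z0q; apply: z0_max].
Qed.

Lemma lower_bounded_of_depends_wf :
  well_founded (fun b a : L => depends a b) -> lower_bounded f.
Proof.
move=> wf.
have ji_least a a' : join_irred_over a a' -> has_least_preimage f a.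
  elim/(well_founded_ind wf): a a' => a IHa a' jia.
  apply: (has_least_preimage_of_depends jia) => b ab.
  by have [_ [b' [_ [[_ jib _] _]]]] := ab; apply: IHa ab _ jib.
move=> a A; right.
have [m [le_ma m_least m_max]] := greatest_with_least_preimage a.
have le_am : a <= m.
  have [//|/negP nle_am] := boolP (a <= m); exfalso.
  have [b [b' [jib le_ba nle_bm _]]] := join_irred_not_below L_fin nle_am.
  by apply: nle_bm; apply: m_max => //; apply: ji_least jib.
have eq_ma : m = a by apply: le_anti; rewrite le_ma.
rewrite eq_ma in m_least.
by have [u [le_a_fu u_min]] := m_least; exists u; split=> // v; apply: u_min.
Qed.

End LowerBounded.

(** * Free lattices *)

Inductive term (X : Type) : Type :=
| Gen of X
| Meet of term X & term X
| Join of term X & term X.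

HB.instance Definition _ X := gen_eqMixin (term X).
HB.instance Definition _ X := gen_choiceMixin (term X).

(** Provability of an inequality from the lattice axioms. *)
Inductive term_le (X : Type) : term X -> term X -> Prop :=
| term_le_refl s : term_le s s
| term_le_trans t s u : term_le s t -> term_le t u -> term_le s u
| term_leIl s t : term_le (Meet s t) s
| term_leIr s t : term_le (Meet s t) t
| term_lexI u s t : term_le u s -> term_le u t -> term_le u (Meet s t)
| term_leUl s t : term_le s (Join s t)
| term_leUr s t : term_le t (Join s t)
| term_leUx u s t : term_le s u -> term_le t u -> term_le (Join s t) u.

Section FreeLattice.
Variable X : Type.

Definition term_equiv (s t : term X) : bool :=
  `[< term_le s t /\ term_le t s >].

Lemma term_equiv_refl : reflexive term_equiv.
Proof. by move=> s; apply/asboolP; split; apply: term_le_refl. Qed.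

Lemma term_equiv_sym : ssrbool.symmetric term_equiv.
Proof. by move=> s t; apply/asboolP/asboolP => -[]. Qed.

Lemma term_equiv_trans : ssrbool.transitive term_equiv.
Proof.
move=> t s u /asboolP[st ts] /asboolP[tu ut].
apply/asboolP; split; first exact: term_le_trans st tu.
exact: term_le_trans ut ts.
Qed.

Canonical term_equiv_rel :=
  EquivRel term_equiv term_equiv_refl term_equiv_sym term_equiv_trans.

Definition free_lattice : Type := {eq_quot term_equiv_rel}%qT.
HB.instance Definition _ := Choice.on free_lattice.

Definition class (t : term X) : free_lattice :=
  \pi_{eq_quot term_equiv_rel}%qT t.
Definition rep (u : free_lattice) : term X :=
  repr (u : {eq_quot term_equiv_rel}%qT).

Lemma repK : cancel rep class.
Proof. exact: reprK. Qed.

Lemma rep_class (t : term X) :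
  term_le (rep (class t)) t /\ term_le t (rep (class t)).
Proof.
have /eqmodP/asboolP[] : (class (rep (class t)) = class t) by rewrite repK.
by [].
Qed.

Definition free_le (u v : free_lattice) : bool :=
  `[< term_le (rep u) (rep v) >].
Definition free_meet (u v : free_lattice) := class (Meet (rep u) (rep v)).
Definition free_join (u v : free_lattice) := class (Join (rep u) (rep v)).

Lemma free_le_refl : reflexive free_le.
Proof. by move=> u; apply/asboolP; apply: term_le_refl. Qed.

Lemma free_le_anti : antisymmetric free_le.
Proof.
move=> u v /andP[/asboolP uv /asboolP vu].
by rewrite -(repK u) -(repK v); apply/eqmodP/asboolP.
Qed.

Lemma free_le_trans : ssrbool.transitive free_le.
Proof.
move=> v u w /asboolP uv /asboolP vw.
by apply/asboolP; apply: term_le_trans uv vw.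
Qed.

Lemma free_lexI (u v w : free_lattice) :
  free_le u (free_meet v w) = free_le u v && free_le u w.
Proof.
have [le_r ge_r] := rep_class (Meet (rep v) (rep w)).
apply/asboolP/andP => [u_vw|[/asboolP uv /asboolP uw]].
  have {}u_vw := term_le_trans u_vw le_r.
  by split; apply/asboolP; apply: term_le_trans u_vw _;
    [apply: term_leIl|apply: term_leIr].
by apply: term_le_trans ge_r; apply: term_lexI.
Qed.

Lemma free_leUx (u v w : free_lattice) :
  free_le (free_join u v) w = free_le u w && free_le v w.
Proof.
have [le_r ge_r] := rep_class (Join (rep u) (rep v)).
apply/asboolP/andP => [uv_w|[/asboolP uw /asboolP vw]].
  have {}uv_w := term_le_trans ge_r uv_w.
  by split; apply/asboolP; apply: term_le_trans uv_w;
    [apply: term_leUl|apply: term_leUr].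
by apply: term_le_trans le_r _; apply: term_leUx.
Qed.

Fact free_display : Order.disp_t. Proof. exact: Order.Disp tt tt. Qed.

HB.instance Definition _ := Order.Le_isPOrder.Build free_display free_lattice
  free_le_refl free_le_anti free_le_trans.
HB.instance Definition _ := Order.POrder_MeetJoin_isLattice.Build free_display
  free_lattice free_lexI free_leUx.

Definition free_gen (x : X) : free_lattice := class (Gen x).

Section Evaluation.
Variables (d : Order.disp_t) (L : latticeType d) (f : X -> L).

Fixpoint eval (t : term X) : L :=
  match t with
  | Gen x => f x
  | Meet s t => eval s `&` eval t
  | Join s t => eval s `|` eval t
  end.

Lemma eval_le (s t : term X) : term_le s t -> eval s <= eval t.
Proof.
elim=> {s t} //=.
- by move=> t s u _ st _; apply: le_trans st.
- by move=> s t; apply: leIl.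
- by move=> s t; apply: leIr.
- by move=> u s t _ us _ ut; rewrite lexI us.
- by move=> s t; apply: leUl.
- by move=> s t; apply: leUr.
- by move=> u s t _ su _ tu; rewrite leUx su.
Qed.

Lemma eval_rep_class (t : term X) : eval (rep (class t)) = eval t.
Proof.
by have [le_r ge_r] := rep_class t; apply: le_anti; rewrite !eval_le.
Qed.

Definition free_extension (u : free_lattice) : L := eval (rep u).

Lemma free_extension_homo : {homo free_extension : u v / u <= v}.
Proof. by move=> u v /asboolP uv; apply: eval_le. Qed.

Lemma free_extensionI : {morph free_extension : u v / u `&` v}.
Proof. by move=> u v; apply: eval_rep_class. Qed.

Lemma free_extensionU : {morph free_extension : u v / u `|` v}.
Proof. by move=> u v; apply: eval_rep_class. Qed.

HB.instance Definition _ := Order.isOrderMorphism.Build _ _ _ _ free_extension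
  free_extension_homo.
HB.instance Definition _ := Order.isLatticeMorphism.Build _ _ _ _ free_extension
  free_extensionI free_extensionU.

Lemma free_extension_gen (x : X) : free_extension (free_gen x) = f x.
Proof. exact: eval_rep_class. Qed.

End Evaluation.

Lemma free_gen_generates : generated_by free_gen.
Proof.
move=> S Sgen SI SU u; rewrite -(repK u).
have class_le (s t : term X) : term_le s t -> class s <= class t.
  move=> st; apply/asboolP.
  have [le_s _] := rep_class s; have [_ ge_t] := rep_class t.
  exact: term_le_trans le_s (term_le_trans st ge_t).
elim: (rep u) => [x|s IHs t IHt|s IHs t IHt]; first exact: Sgen.
- suff -> : class (Meet s t) = class s `&` class t by apply: SI.
  apply: le_anti; rewrite lexI !class_le; try by constructor.
  have [le_s _] := rep_class s; have [le_t _] := rep_class t.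
  by apply: term_lexI;
    [apply: term_le_trans le_s; apply: term_leIl
    |apply: term_le_trans le_t; apply: term_leIr].
suff -> : class (Join s t) = class s `|` class t by apply: SU.
apply: le_anti; rewrite leUx !class_le ?andbT; try by constructor.
have [_ ge_s] := rep_class s; have [_ ge_t] := rep_class t.
by apply: term_leUx;
  [apply: term_le_trans ge_s _; apply: term_leUl
  |apply: term_le_trans ge_t _; apply: term_leUr].
Qed.

Lemma free_latticeP : is_free_lattice X free_lattice.
Proof.
exists free_gen; split=> //; first exact: free_gen_generates.
move=> d' L f _; exists (free_extension f); exact: free_extension_gen.
Qed.

End FreeLattice.

(** * Bounded homomorphisms *)

(** The homomorphism is given as a plain function preserving both operations, so
    that the statement applies as it stands to the dual lattices. *)
Lemma near_distributive_lower_bounded (d d' : Order.disp_t) (K : latticeType d)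
    (L : latticeType d') (X : finType) (i : X -> K) (f : K -> L) :
  generated_by i -> (forall a, exists u, f u = a) ->
  {morph f : u v / u `&` v} -> {morph f : u v / u `|` v} ->
  finite_set [set: L]%classic -> SD2_meet L -> SD2_join L -> lower_bounded f.
Proof.
move=> i_gen f_surj fI fU L_fin SDm SDj.
apply: (lower_bounded_of_depends_wf i_gen f_surj fI fU L_fin).
exact: (depends_wf L_fin SDm SDj).
Qed.

Lemma near_distributive_upper_bounded (d d' : Order.disp_t) (K : latticeType d)
    (L : latticeType d') (X : finType) (i : X -> K) (f : K -> L) :
  generated_by i -> (forall a, exists u, f u = a) ->
  {morph f : u v / u `&` v} -> {morph f : u v / u `|` v} ->
  finite_set [set: L]%classic -> SD2_meet L -> SD2_join L -> upper_bounded f.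
Proof.
move=> i_gen f_surj fI fU L_fin SDm SDj.
apply: (@near_distributive_lower_bounded _ _ K^d L^d X i f) => //.
by move=> S Sgen SI SU; apply: i_gen.
Qed.

Lemma near_distributive_bounded (d : Order.disp_t) (L : latticeType d)
    (X : finType) (i : X -> L) :
  generated_by i -> finite_set [set: L]%classic -> S2 L -> bounded_lattice L.
Proof.
move=> i_gen L_fin [SDm SDj]; split=> //.
pose f : {lmorphism free_lattice X -> L} := free_extension i.
have f_surj a : exists u, f u = a.
  apply: (i_gen (fun a => exists u, f u = a)) a =>
      [x|_ _ [u <-] [v <-]|_ _ [u <-] [v <-]].
  - by exists (free_gen x); apply: free_extension_gen.
  - by exists (u `&` v); apply: omorphI.
  - by exists (u `|` v); apply: omorphU.
have gen := @free_gen_generates X.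
exists X, free_display, (free_lattice X), f; split.
- exact: free_latticeP.
- by move=> a _; have [u <-] := f_surj a; exists u.
split.
  exact: (near_distributive_lower_bounded gen f_surj (omorphI f) (omorphU f)
    L_fin SDm SDj).
exact: (near_distributive_upper_bounded gen f_surj (omorphI f) (omorphU f)
    L_fin SDm SDj).
Qed.

Theorem proposition5 (n : nat) (n_gt0 : (0 < n)%N) (d : Order.disp_t)
    (F : latticeType d) (F_free : relatively_free_on S2 n F)
    (F_fin : finite_set [set: F]%classic) :
  bounded_lattice F.
Proof.
have [X [i [_ [F_S2 i_gen _]]]] := F_free.
exact: near_distributive_bounded i_gen F_fin F_S2.
Qed.
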